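(* The Segre variety $\mathcal{S}_{1,1,1}(2)$ is a hypersurface in $\operatorname{PG}(7,2)$ which has the sextic equation $Q_6(x)=0$, where $$Q_6=P_2'+P_2''+P_3''+P_4'+P_4'''+P_4^{\mathrm{v}}+P_5+P_6.$$
   Context: Everything is over $\operatorname{GF}(2)$. Let $V_2$ be a 2-dimensional vector space over $\operatorname{GF}(2)$ with nonzero vectors $u_0,u_1,u_2$ (so $u_2=u_0+u_1$), and $V_8=V_2\otimes V_2\otimes V_2$. Points of $\operatorname{PG}(7,2)=\mathbb{P}V_8$ are identified with nonzero vectors of $V_8$. Put $E_{ijk}=u_i\otimes u_j\otimes u_k$ for $i,j,k\in\{0,1,2\}$. The Segre variety is the 27-point set $\mathcal{S}_{1,1,1}(2)=\{E_{ijk}\}$. Saying that a point set has equation $Q(x)=0$ means that it is exactly the set of points $x$ of $\operatorname{PG}(7,2)$ (nonzero vectors) with $Q(x)=0$. Coordinates $x_1,\dots,x_8$ are with respect to the basis $e_1=E_{000}$, $e_2=E_{100}$, $e_3=E_{110}$, $e_4=E_{010}$, $e_5=E_{101}$, $e_6=E_{001}$, $e_7=E_{011}$, $e_8=E_{111}$. Writing $ij$, $ijk$, $ijkl$ for the monomials $x_ix_j$, $x_ix_jx_k$, $x_ix_jx_kx_l$: $P_2'=13+15+17+35+37+57+24+26+28+46+48+68$; $P_2''=18+27+36+45$; $P_3''=\sum_{i\ne1,8}x_1x_8x_i+\sum_{i\ne2,7}x_2x_7x_i+\sum_{i\ne3,6}x_3x_6x_i+\sum_{i\ne4,5}x_4x_5x_i$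 (with $i\in\{1,\dots,8\}$); $P_4'=1278+1368+1458+2367+2457+3456$; $P_4'''=1357+2468$; $P_4^{\mathrm{v}}=1248+1268+1468+1358+1378+1578+1237+1257+2357+2467+2478+2678+2346+2368+3468+1356+1367+3567+1345+1457+3457+2456+2458+4568$; $P_5=x_1x_3x_5x_7(x_2+x_4+x_6+x_8)+x_2x_4x_6x_8(x_1+x_3+x_5+x_7)$; $P_6=x_1x_2x_3x_6x_7x_8+x_1x_2x_4x_5x_7x_8+x_1x_3x_4x_5x_6x_8+x_2x_3x_4x_5x_6x_7$. *)

(* Defs.v *)
From HB Require Import structures.
From mathcomp Require Import all_boot all_order all_algebra.
From mathcomp Require Import mpoly.
Set Implicit Arguments.
Unset Strict Implicit.
Unset Printing Implicit Defensive.
Import GRing.Theory.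
Local Open Scope ring_scope.

Definition trilinear (F : fieldType) (V W : lmodType F) (f : V -> V -> V -> W) :=
  [/\ forall y z, linear (fun x => f x y z),
      forall x z, linear (fun y => f x y z)
    & forall x y, linear (fun z => f x y z)].

(* [T], with [t x y z] in the role of x (x) y (x) z, is V (x) V (x) V: this is
   the universal property, which determines (T, t) up to unique isomorphism. *)
Definition is_tensor_cube (F : fieldType) (V T : lmodType F)
    (t : V -> V -> V -> T) : Prop :=
  trilinear t /\
  forall (W : lmodType F) (f : V -> V -> V -> W), trilinear f ->
    exists g : {linear T -> W},
      (forall x y z, g (t x y z) = f x y z) /\
      forall g' : {linear T -> W},
        (forall x y z, g' (t x y z) = f x y z) -> g' =1 g.

Section Segre.
Variables (V2 V8 : vectType 'F_2) (t : V2 -> V2 -> V2 -> V8) (u : 'I_3 -> V2).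

Definition E (i j k : 'I_3) : V8 := t (u i) (u j) (u k).

Definition segre (x : V8) : Prop := exists i j k, x = E i j k.

Definition segre_basis : 8.-tuple V8 :=
  [tuple E 0 0 0; E 1 0 0; E 1 1 0; E 0 1 0;
         E 1 0 1; E 0 0 1; E 0 1 1; E 1 1 1].

End Segre.

(* The points of PG(7,2) are the nonzero vectors of V8. *)
Definition has_equation (V8 : vectType 'F_2) (e : 8.-tuple V8)
    (S : V8 -> Prop) (Q : {mpoly 'F_2[8]}) : Prop :=
  forall x : V8, S x <-> x != 0 /\ Q.@[fun i => coord e i x] = 0.

(* Variables are numbered from 1 to 8, hence the shift: [X k] is x_k. *)
Definition X (k : nat) : {mpoly 'F_2[8]} := 'X_(inord k.-1 : 'I_8).

(* Each inner list of indices stands for a monomial. *)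
Definition monos (s : seq (seq nat)) : {mpoly 'F_2[8]} :=
  \sum_(m <- s) \prod_(k <- m) X k.

Definition P2' := monos
  [:: [:: 1; 3]; [:: 1; 5]; [:: 1; 7]; [:: 3; 5]; [:: 3; 7]; [:: 5; 7];
      [:: 2; 4]; [:: 2; 6]; [:: 2; 8]; [:: 4; 6]; [:: 4; 8]; [:: 6; 8]]%N.

Definition P2'' := monos [:: [:: 1; 8]; [:: 2; 7]; [:: 3; 6]; [:: 4; 5]]%N.

Definition P3'' : {mpoly 'F_2[8]} :=
    \sum_(1 <= i < 9 | (i != 1)%N && (i != 8)%N) X 1 * X 8 * X i
  + \sum_(1 <= i < 9 | (i != 2)%N && (i != 7)%N) X 2 * X 7 * X i
  + \sum_(1 <= i < 9 | (i != 3)%N && (i != 6)%N) X 3 * X 6 * X i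
  + \sum_(1 <= i < 9 | (i != 4)%N && (i != 5)%N) X 4 * X 5 * X i.

Definition P4' := monos
  [:: [:: 1; 2; 7; 8]; [:: 1; 3; 6; 8]; [:: 1; 4; 5; 8];
      [:: 2; 3; 6; 7]; [:: 2; 4; 5; 7]; [:: 3; 4; 5; 6]]%N.

Definition P4''' := monos [:: [:: 1; 3; 5; 7]; [:: 2; 4; 6; 8]]%N.

Definition P4v := monos
  [:: [:: 1; 2; 4; 8]; [:: 1; 2; 6; 8]; [:: 1; 4; 6; 8]; [:: 1; 3; 5; 8];
      [:: 1; 3; 7; 8]; [:: 1; 5; 7; 8]; [:: 1; 2; 3; 7]; [:: 1; 2; 5; 7];
      [:: 2; 3; 5; 7]; [:: 2; 4; 6; 7]; [:: 2; 4; 7; 8]; [:: 2; 6; 7; 8];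
      [:: 2; 3; 4; 6]; [:: 2; 3; 6; 8]; [:: 3; 4; 6; 8]; [:: 1; 3; 5; 6];
      [:: 1; 3; 6; 7]; [:: 3; 5; 6; 7]; [:: 1; 3; 4; 5]; [:: 1; 4; 5; 7];
      [:: 3; 4; 5; 7]; [:: 2; 4; 5; 6]; [:: 2; 4; 5; 8]; [:: 4; 5; 6; 8]]%N.

Definition P5 : {mpoly 'F_2[8]} :=
    X 1 * X 3 * X 5 * X 7 * (X 2 + X 4 + X 6 + X 8)
  + X 2 * X 4 * X 6 * X 8 * (X 1 + X 3 + X 5 + X 7).

Definition P6 := monos
  [:: [:: 1; 2; 3; 6; 7; 8]; [:: 1; 2; 4; 5; 7; 8];
      [:: 1; 3; 4; 5; 6; 8]; [:: 2; 3; 4; 5; 6; 7]]%N.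

Definition Q6 : {mpoly 'F_2[8]} :=
  P2' + P2'' + P3'' + P4' + P4''' + P4v + P5 + P6.

(* Main.v *)
Require Import Defs.
From HB Require Import structures.
From mathcomp Require Import all_boot all_order all_algebra.
From mathcomp Require Import mpoly.
Set Implicit Arguments.
Unset Strict Implicit.
Unset Printing Implicit Defensive.
Import GRing.Theory.
Local Open Scope ring_scope.

(** Let [e] be the basis of the eight products of [u 0] and [u 1].  In the basis
    [(u 0, u 1)] of [V2] the vectors [u 0], [u 1] and [u 2 = u 0 + u 1] have
    coordinates (1, 0), (0, 1) and (1, 1), so the coordinates in [e] of the point
    [E t u p q r] are the products of these bits ([coord_segre]).  That [e] is
    a basis at all comes from the universal property of the tensor cube: its
    existence part gives linear forms dual to [e], hence freeness; its uniqueness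
    part shows that the projection built from these forms is the identity, hence
    generation ([product_basis_full]).

    The theorem is then about functions on GF(2)^8.  Each such function is the
    value of exactly one polynomial without squares, and [Q6] is the one whose
    zeros are the origin and the 27 product vectors.  This is an identity of
    functions on 256 points, checked at each of them ([segre_bits_zeros]).

    The degree can be predicted by counting zeros.  In the squarefree polynomial
    of a function, the coefficient of the product of a set J of variables is the
    sum of the values at the points supported in J, hence, if J is nonempty, the
    parity of the number of zeros supported in J.  There are 28 zeros in all, and
    each coordinate is nonzero at 8 of them, so the products of eight and of seven
    variables do not occur.  The fourth and the fifth coordinate are both nonzero
    at the single point [E t u 2 2 2], so 28 - 8 - 8 + 1 = 13 zeros are supported
    away from them, and the product of the six other variables does occur.  The
    proof reads off this coefficient from the list of monomials of [Q6]
    ([mcoeff_monos]). *)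

(** * The product basis of a tensor cube *)

Section TensorCube.
Variables (F : fieldType) (V T : vectType F) (t : V -> V -> V -> T).
Hypothesis t_cube : is_tensor_cube t.

Lemma linear_basis_expansion n (b : n.-tuple V) (f : V -> T) v :
  basis_of fullv b -> linear f -> f v = \sum_i coord b i v *: f b`_i.
Proof.
move=> b_basis f_lin; pose m := GRing.isLinear.Build F V T *:%R f f_lin.
pose g : {linear V -> T} := HB.pack f m.
rewrite -[f]/(g : V -> T) {1}(coord_basis b_basis (memvf v)) linear_sum.
by apply: eq_bigr => i _; rewrite linearZ.
Qed.

Lemma trilinear_expansion n (b : n.-tuple V) x y z :
    basis_of fullv b ->
  t x y z = \sum_(d : 'I_n * 'I_n * 'I_n)
    (coord b d.1.1 x * coord b d.1.2 y * coord b d.2 z)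
      *: t b`_d.1.1 b`_d.1.2 b`_d.2.
Proof.
move=> b_basis; case: t_cube => -[lin1 lin2 lin3] _.
rewrite -(pair_bigA _ (fun d k =>
  (coord b d.1 x * coord b d.2 y * coord b k z) *: t b`_d.1 b`_d.2 b`_k)) /=.
rewrite -(pair_bigA _ (fun i j => \sum_k
  (coord b i x * coord b j y * coord b k z) *: t b`_i b`_j b`_k)) /=.
rewrite (linear_basis_expansion x b_basis (lin1 y z)).
apply: eq_bigr => i _.
rewrite (linear_basis_expansion y b_basis (lin2 b`_i z)) scaler_sumr.
apply: eq_bigr => j _.
rewrite (linear_basis_expansion z b_basis (lin3 b`_i b`_j)) !scaler_sumr.
by apply: eq_bigr => k _; rewrite !scalerA.
Qed.

(** The existence part of the universal property, applied to a product of forms. *)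
Lemma tensor_of_scalar_forms (a b c : {scalar V}) :
  exists g : {scalar T}, forall x y z, g (t x y z) = a x * b y * c z.
Proof.
case: t_cube => _ /(_ F^o (fun x y z => a x * b y * c z)) [|g [gE _]].
  split=> [y z|x z|x y] k p q; rewrite linearP /=.
  - by rewrite !mulrDl -!mulrA.
  - by rewrite mulrDr mulrDl mulrCA -!mulrA.
  - by rewrite mulrDr mulrCA.
by exists g.
Qed.

(** The uniqueness part of the universal property, applied to the trilinear map
    that [h] induces. *)
Lemma tensor_ext (W : lmodType F) (g h : {linear T -> W}) :
  (forall x y z, g (t x y z) = h (t x y z)) -> g =1 h.
Proof.
move=> gh v; case: t_cube => -[lin1 lin2 lin3] /(_ W (fun x y z => h (t x y z))).
case=> [|k [_ k_uniq]].
  split=> [y z|x z|x y] a p q.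
  - by rewrite lin1 linearP.
  - by rewrite lin2 linearP.
  - by rewrite lin3 linearP.
by rewrite (k_uniq g gh) (k_uniq h).
Qed.

Variables (n m : nat) (b : n.-tuple V) (d : 'I_m -> 'I_n * 'I_n * 'I_n).
Variable e : m.-tuple T.
Hypothesis b_basis : basis_of fullv b.
Hypothesis d_bij : bijective d.
Hypothesis eE : forall l : 'I_m, e`_l = t b`_(d l).1.1 b`_(d l).1.2 b`_(d l).2.

(** These forms are dual to [e]: they take [e] to the identity matrix because
    [d] is injective. *)
Lemma product_basis_dual_forms :
  exists phi : 'I_m -> {scalar T}, forall l x y z,
    phi l (t x y z)
    = coord b (d l).1.1 x * coord b (d l).1.2 y * coord b (d l).2 z.
Proof.
have ex (l : 'I_m) := tensor_of_scalar_forms (coord b (d l).1.1) (coord b (d l).1.2)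
  (coord b (d l).2).
by have [phi phiE] := fin_all_exists ex; exists phi.
Qed.

(** The right-hand side is linear in [v] and fixes every [t x y z], because [d] is
    onto; by uniqueness it is the identity. *)
Lemma product_basis_expansion (phi : 'I_m -> {scalar T}) v :
    (forall l x y z, phi l (t x y z)
       = coord b (d l).1.1 x * coord b (d l).1.2 y * coord b (d l).2 z) ->
  v = \sum_l phi l v *: e`_l.
Proof.
move=> phiE; pose r w := \sum_l phi l w *: e`_l.
have r_lin : linear r.
  move=> k p q; rewrite /r scaler_sumr -big_split /=.
  by apply: eq_bigr => l _; rewrite linearP scalerDl scalerA.
pose rm := GRing.isLinear.Build F T T *:%R r r_lin.
pose rl : {linear T -> T} := HB.pack r rm.
rewrite -[RHS]/(rl v); apply: (@tensor_ext _ idfun rl) => x y z /=.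
transitivity (\sum_l phi l (t x y z) *: e`_l); last by [].
rewrite [LHS](trilinear_expansion x y z b_basis).
rewrite (reindex d) /=; last exact: onW_bij.
by apply: eq_bigr => l _; rewrite phiE eE.
Qed.

Lemma product_basis_free : free e.
Proof.
have [phi phiE] := product_basis_dual_forms.
apply/freeP => k k0 l; have := congr1 (phi l) k0.
rewrite linear0 linear_sum (bigD1 l) //= big1 => [|i il].
  rewrite linearZ /= eE phiE !coord_free ?(basis_free b_basis) //.
  by rewrite !eqxx !mulr1 addr0.
rewrite linearZ /= eE phiE !coord_free ?(basis_free b_basis) //.
rewrite -!natrM !mulnb -!xpair_eqE -!surjective_pairing.
by rewrite (inj_eq (bij_inj d_bij)) (negPf il) mulr0.
Qed.

Lemma product_basis_full : basis_of fullv e.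
Proof.
have [phi phiE] := product_basis_dual_forms.
rewrite basisEfree product_basis_free subvf /=.
apply: leq_trans (dim_span e); apply: dimvS; apply/subvP => v _.
rewrite (product_basis_expansion v phiE); apply: memv_suml => l _.
by apply/memvZ/memv_span/mem_nth; rewrite size_tuple.
Qed.

Lemma coord_product_basis l x y z :
  coord e l (t x y z)
  = coord b (d l).1.1 x * coord b (d l).1.2 y * coord b (d l).2 z.
Proof.
have [phi phiE] := product_basis_dual_forms.
rewrite [t x y z](product_basis_expansion _ phiE).
by rewrite coord_sum_free ?product_basis_free // phiE.
Qed.

End TensorCube.

(** * Polynomials given by lists of monomials *)

Lemma monos_cat s1 s2 : monos (s1 ++ s2) = monos s1 + monos s2.
Proof. exact: big_cat. Qed.

Lemma monos_rcons m s :
  monos [seq rcons m i | i <- s] = \prod_(k <- m) X k * \sum_(i <- s) X i.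
Proof.
rewrite /monos big_map mulr_sumr; apply: eq_bigr => i _.
by rewrite -cats1 big_cat big_seq1.
Qed.

(** The list of monomials is read off from the definitions, so that it cannot
    differ from them. *)
Ltac monomials_of P :=
  let p := eval red in P in match p with monos ?s => exact s end.

Definition Q6_monomials : seq (seq nat) :=
  ltac:(monomials_of P2') ++ ltac:(monomials_of P2'')
  ++ flatten [seq [seq [:: p.1; p.2; i]
                   | i <- index_iota 1 9 & (i != p.1) && (i != p.2)]
             | p <- [:: (1, 8); (2, 7); (3, 6); (4, 5)]]%N
  ++ ltac:(monomials_of P4') ++ ltac:(monomials_of P4''')
  ++ ltac:(monomials_of P4v)
  ++ ([seq [:: 1; 3; 5; 7; i] | i <- [:: 2; 4; 6; 8]]%N
      ++ [seq [:: 2; 4; 6; 8; i] | i <- [:: 1; 3; 5; 7]]%N)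
  ++ ltac:(monomials_of P6).

Lemma Q6_monos : Q6 = monos Q6_monomials.
Proof.
have P3E : P3'' = monos (flatten [seq [seq [:: p.1; p.2; i]
                   | i <- index_iota 1 9 & (i != p.1) && (i != p.2)]
             | p <- [:: (1, 8); (2, 7); (3, 6); (4, 5)]])%N.
  have pairE a b (s : seq nat) (P : pred nat) :
      \sum_(i <- s | P i) X a * X b * X i
      = monos [seq rcons [:: a; b] i | i <- s & P i].
    rewrite monos_rcons big_filter mulr_sumr; apply: eq_bigr => i _.
    by rewrite !big_cons big_nil mulr1.
  by rewrite /P3'' !pairE -!monos_cat.
have P5E : P5 = monos [seq [:: 1; 3; 5; 7; i] | i <- [:: 2; 4; 6; 8]]%N
   + monos [seq [:: 2; 4; 6; 8; i] | i <- [:: 1; 3; 5; 7]]%N.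
  rewrite (monos_rcons [:: 1; 3; 5; 7]%N) (monos_rcons [:: 2; 4; 6; 8]%N).
  by rewrite !big_cons !big_nil !mulr1 !addr0 !mulrA !addrA.
(* Only the top-level sums are reassociated: the parts are sums themselves. *)
by rewrite /Q6_monomials 3!monos_cat -P3E !monos_cat -P5E 6!addrA.
Qed.

Definition var_range (k : nat) := (0 < k < 9)%N.

Definition exponents (m : seq nat) : 'X_{1..8} :=
  (\sum_(k <- m) U_(inord k.-1 : 'I_8))%MM.

Lemma prod_X m : \prod_(k <- m) X k = 'X_[exponents m].
Proof. by rewrite /exponents -mprodXE. Qed.

(** The range matters: variables are numbered from 1, and [X] sends both 0 and 1
    to the first variable. *)
Lemma exponents_perm m m' : all var_range m -> all var_range m' ->
  (exponents m == exponents m') = perm_eq m m'.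
Proof.
move=> m_ok m'_ok.
have expE r (i : 'I_8) : all var_range r -> exponents r i = count_mem i.+1 r.
  move=> r_ok; rewrite /exponents mnm_sumE -sum1_count [RHS]big_mkcond /=.
  rewrite big_seq [RHS]big_seq; apply: eq_bigr => k /(allP r_ok).
  rewrite mnm1E -val_eqE /= => /andP[k_gt0 k_lt9].
  by case: k k_gt0 k_lt9 => // k _ k_lt8; rewrite inordK // eqSS; case: eqP.
apply/eqP/idP => [eqm|eqm].
  apply/allP => k; rewrite mem_cat => km /=.
  have /andP[k_gt0 k_lt9] : var_range k.
    by case/orP: km => [/(allP m_ok)|/(allP m'_ok)].
  have i_lt8 : (k.-1 < 8)%N by rewrite prednK.
  have := congr1 (fun w : 'X_{1..8} => w (Ordinal i_lt8)) eqm.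
  by rewrite !expE //= prednK // => ->.
by apply/mnmP => i; rewrite !expE //; apply/permP.
Qed.

Lemma mdeg_exponents m : mdeg (exponents m) = size m.
Proof.
rewrite /exponents mdeg_sum -sum1_size.
by apply: eq_bigr => k _; rewrite mdeg1.
Qed.

(** Counting repeated monomials turns a coefficient into a computation on lists of
    numbers. *)
Lemma mcoeff_monos s m : all (all var_range) s -> all var_range m ->
  (monos s)@_(exponents m) = (count (fun r => perm_eq r m) s)%:R.
Proof.
move=> s_ok m_ok; rewrite /monos raddf_sum /= -sum1_count natr_sum.
rewrite [RHS]big_mkcond big_seq [RHS]big_seq; apply: eq_bigr => r rs.
rewrite prod_X mcoeffX exponents_perm ?(allP s_ok _ rs) //.
by case: (perm_eq _ _).
Qed.

Lemma msize_monos_le s d : all (fun m => size m <= d)%N s ->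
  (msize (monos s) <= d.+1)%N.
Proof.
move=> s_le; apply: leq_trans (msize_sum _ _ _) _.
rewrite big_seq; apply/bigmax_leqP_seq => m ms _.
by rewrite prod_X msizeX mdeg_exponents ltnS (allP s_le).
Qed.

Lemma msize_Q6 : msize Q6 = 7%N.
Proof.
(* Every monomial of degree 6 in [Q6] would do. *)
pose m := [:: 1; 2; 3; 6; 7; 8]%N.
apply/eqP; rewrite eqn_leq Q6_monos msize_monos_le //=.
suffices: exponents m \in msupp (monos Q6_monomials).
  by move/msize_mdeg_lt; rewrite mdeg_exponents.
by rewrite mcoeff_msupp mcoeff_monos.
Qed.

(** * Evaluation at Boolean points *)

(** A value of a polynomial over GF(2), with exclusive or as sum and conjunction as
    product: unlike [meval], it reduces by computation. *)
Definition monos_bool (s : seq (seq nat)) (c : seq bool) : bool :=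
  foldr (fun m acc => all (fun k => nth false c k.-1) m (+) acc) false s.

Lemma natr_addb (a b : bool) : (a (+) b)%:R = a%:R + b%:R :> 'F_2.
Proof. by case: a; case: b; apply/eqP. Qed.

Lemma F2_bool (x : 'F_2) : x = (x != 0)%:R.
Proof. by apply/eqP; case: x => -[|[|//]]. Qed.

Lemma meval_monos s (c : 8.-tuple bool) : all (all var_range) s ->
  (monos s).@[fun i => (tnth c i)%:R] = (monos_bool s c)%:R.
Proof.
have eval_prod m : all var_range m ->
    (\prod_(k <- m) X k).@[fun i => (tnth c i)%:R : 'F_2]
    = (all (fun k => nth false c k.-1) m)%:R.
  elim: m => [|k m IHm] /=; first by rewrite big_nil meval1.
  case/andP=> /andP[k_gt0 k_lt9] /IHm m_ok; rewrite big_cons mevalM m_ok.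
  rewrite /X mevalXU (tnth_nth false) inordK ?prednK //.
  by rewrite -natrM mulnb.
elim: s => [|m s IHs] /=; first by rewrite /monos big_nil meval0.
case/andP=> m_ok s_ok; rewrite /monos big_cons mevalD eval_prod // natr_addb.
by rewrite -[X in _ + X.@[_]]/(monos s) IHs.
Qed.

(** * The Segre variety in coordinates *)

(** The indices, in the basis of [V2], of the factors of the eight basis points. *)
Definition digits : 8.-tuple ('I_2 * 'I_2 * 'I_2) :=
  [tuple (0, 0, 0); (1, 0, 0); (1, 1, 0); (0, 1, 0);
         (1, 0, 1); (0, 0, 1); (0, 1, 1); (1, 1, 1)].

Lemma digits_bij : bijective (tnth digits).
Proof.
apply: inj_card_bij; last by rewrite !card_prod !card_ord.
exact/tuple_uniqP.
Qed.

(** The coordinate of index [i] of [u p], where [u 2 = u 0 + u 1]. *)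
Definition point_bit (p i : nat) : bool := (p == 2) || (p == i).

Definition segre_bits (p q r : nat) : seq bool :=
  [seq point_bit p d.1.1 && point_bit q d.1.2 && point_bit r d.2
  | d : 'I_2 * 'I_2 * 'I_2 <- digits].

Definition all_segre_bits : seq (seq bool) :=
  [seq segre_bits p qr.1 qr.2
  | p <- iota 0 3, qr <- allpairs pair (iota 0 3) (iota 0 3)].

(** The heart of the theorem, by evaluation at the 256 vectors of GF(2)^8. *)
Lemma segre_bits_zeros (c : 8.-tuple bool) :
  (tval c \in all_segre_bits) = has id c && ~~ monos_bool Q6_monomials c.
Proof.
case: c => c c8 /=.
case: c c8 => [|b0 [|b1 [|b2 [|b3 [|b4 [|b5 [|b6 [|b7 [|? ?]]]]]]]]] //= _.
by case: b0; case: b1; case: b2; case: b3;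
   case: b4; case: b5; case: b6; case: b7; vm_compute.
Qed.

Section SegreCoordinates.
Variables (V2 V8 : vectType 'F_2) (u : 'I_3 -> V2).
Variable t : V2 -> V2 -> V2 -> V8.
Hypothesis V2_dim : \dim {:V2}%VS = 2%N.
Hypothesis u_inj : injective u.
Hypothesis u_neq0 : forall i, u i != 0.
Hypothesis t_cube : is_tensor_cube t.

Definition u_basis : 2.-tuple V2 := [tuple u 0; u 1].

Lemma u_basis_full : basis_of fullv u_basis.
Proof.
rewrite basisEfree subvf V2_dim /= andbT free_cons seq1_free u_neq0 andbT.
rewrite span_seq1; apply/vlineP => -[k]; rewrite (F2_bool k).
case: (k != 0) => [/=|/eqP].
  by rewrite scale1r => /u_inj.
by rewrite scale0r (negPf (u_neq0 _)).
Qed.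

(** Neither coordinate of [u 2] can vanish: otherwise [u 2] would be zero, [u 0]
    or [u 1]. *)
Lemma coord_u p i : coord u_basis i (u p) = (point_bit p i)%:R.
Proof.
have u_free := basis_free u_basis_full.
have u01 (j : 'I_2) : coord u_basis i u_basis`_j = (j == i)%:R.
  exact: coord_free.
have [p0|p0] := eqVneq p 0; first by rewrite p0 (u01 0).
have [p1|p1] := eqVneq p 1; first by rewrite p1 (u01 1).
have p2 : p = 2%N :> nat by case: p p0 p1 => -[|[|[|//]]].
rewrite /point_bit p2 /= [LHS]F2_bool.
have uE := coord_basis u_basis_full (memvf (u p)).
move: uE; rewrite !big_ord_recl big_ord0 addr0 /=.
rewrite [X in X *: u 0]F2_bool [X in X *: u 1]F2_bool => uE.
have [c0 c1] : coord u_basis ord0 (u p) != 0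
    /\ coord u_basis (lift ord0 ord0) (u p) != 0.
  move: uE; do 2 case: (_ != 0);
    rewrite ?scale1r ?scale0r ?add0r ?addr0 // => /eqP;
    by rewrite ?(inj_eq u_inj) ?(negPf p0) ?(negPf p1) ?(negPf (u_neq0 p)).
case: (unliftP ord0 i) => [j ->|->]; last by rewrite c0.
by rewrite (ord1 j) c1.
Qed.

Lemma nth_segre_basis (l : 'I_8) : (segre_basis t u)`_l
  = t u_basis`_(tnth digits l).1.1 u_basis`_(tnth digits l).1.2
      u_basis`_(tnth digits l).2.
Proof. by case: l => -[|[|[|[|[|[|[|[|//]]]]]]]]. Qed.

Lemma coord_segre l p q r : coord (segre_basis t u) l (E t u p q r)
  = (nth false (segre_bits p q r) l)%:R.
Proof.
rewrite (coord_product_basis t_cube u_basis_full digits_bij nth_segre_basis).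
rewrite !coord_u -!natrM !mulnb (nth_map (0, 0, 0)) ?size_tuple //.
by rewrite -tnth_nth.
Qed.

Definition coord_bits (x : V8) : 8.-tuple bool :=
  [tuple coord (segre_basis t u) l x != 0 | l < 8].

Lemma coordE x l :
  coord (segre_basis t u) l x = (tnth (coord_bits x) l)%:R.
Proof. by rewrite tnth_mktuple -F2_bool. Qed.

Lemma segre_basis_full : basis_of fullv (segre_basis t u).
Proof.
exact: (product_basis_full t_cube u_basis_full digits_bij nth_segre_basis).
Qed.

Lemma coord_bits_inj x y : coord_bits x = coord_bits y -> x = y.
Proof.
move=> xy; rewrite (coord_basis segre_basis_full (memvf x)).
rewrite [RHS](coord_basis segre_basis_full (memvf y)).
by apply: eq_bigr => l _; rewrite !coordE xy.
Qed.

Lemma coord_bits_segre p q r : tval (coord_bits (E t u p q r)) = segre_bits p q r.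
Proof.
apply: (@eq_from_nth _ false) => [|l]; rewrite size_tuple ?size_map // => l8.
rewrite -[l]/(val (Ordinal l8)) -tnth_nth tnth_mktuple coord_segre.
by case: (nth _ _ _).
Qed.

Lemma coord_bits_neq0 x : has id (coord_bits x) = (x != 0).
Proof.
apply/idP/idP => [/hasP[c /tnthP[l ->]]|].
  by rewrite tnth_mktuple; apply: contraNN => /eqP->; rewrite linear0.
apply: contra_neqT => /hasPn no; rewrite (coord_basis segre_basis_full (memvf x)).
rewrite big1 // => l _; rewrite coordE.
case bl: (tnth _ l); last by rewrite scale0r.
by have /negP[] := no _ (mem_tnth l (coord_bits x)); rewrite bl.
Qed.

Lemma segreP x : segre t u x <-> tval (coord_bits x) \in all_segre_bits.
Proof.
split=> [[p [q [r ->]]]|].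
  rewrite coord_bits_segre; apply/allpairsP; exists (p : nat, (q : nat, r : nat)).
  split=> //; first by rewrite mem_iota ltn_ord.
  by apply: allpairs_f; rewrite mem_iota ltn_ord.
case/allpairsP=> -[p qr] [p3 /allpairsP[[q r] [q3 r3 ->]]] xE.
rewrite mem_iota /= in p3; rewrite mem_iota /= in q3; rewrite mem_iota /= in r3.
exists (Ordinal p3), (Ordinal q3), (Ordinal r3).
by apply/coord_bits_inj/val_inj; rewrite /= coord_bits_segre.
Qed.

Lemma meval_Q6 x : Q6.@[fun l => coord (segre_basis t u) l x]
  = (monos_bool Q6_monomials (coord_bits x))%:R.
Proof.
by rewrite Q6_monos -meval_monos //; apply: meval_eq => l; exact: coordE.
Qed.

End SegreCoordinates.

(* [msize] is the total degree plus one. *)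
Theorem theorem19 (V2 V8 : vectType 'F_2) (hV2 : \dim {:V2}%VS = 2%N)
    (u : 'I_3 -> V2) (hu : injective u) (hu0 : forall i, u i != 0)
    (t : V2 -> V2 -> V2 -> V8) (ht : is_tensor_cube t) :
  msize Q6 = 7%N /\ has_equation (segre_basis t u) (segre t u) Q6.
Proof.
split=> [|x]; first exact: msize_Q6.
rewrite meval_Q6 (segreP hV2 hu hu0 ht) segre_bits_zeros.
rewrite (coord_bits_neq0 hV2 hu hu0 ht).
by case: (x != 0); case: monos_bool; split=> // -[].
Qed.
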